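(* Let $n\geq 2$ be an integer and let $X$ be an $n$-Urysohn topological space. Then $|X|\leq \pi\chi(X)^{\,c(X)\chi(X)}$.
   Context: Throughout $n\ge 2$ is an integer. The Urysohn number $U(X)$ of a space $X$ is the least cardinal $\kappa$ such that for every $A\subseteq X$ with $|A|\geq\kappa$ there exist open neighbourhoods $U_a$ of $a$ ($a\in A$) with $\bigcap_{a\in A}\overline{U_a}=\emptyset$. $X$ is $n$-Urysohn if $U(X)\leq n$. $\pi\chi(X)$ is the $\pi$-character, $c(X)$ the cellularity and $\chi(X)$ the character of $X$, all multiplied by $\omega$ (so they are always infinite). *)

(* Defs.v *)
From mathcomp Require Import all_boot.
From mathcomp Require Import boolp classical_sets functions cardinality.
From mathcomp Require Import topology.

Set Implicit Arguments.
Unset Strict Implicit.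
Unset Printing Implicit Defensive.

Local Open Scope classical_set_scope.
Local Open Scope card_scope.

(* A cardinal is represented by any type of that cardinality: cardinals are
   compared by [#<=] on full sets, their product is the product type and the
   power kappa ^ lambda is the function type [lambda -> kappa]. *)
Definition is_least_cardinal (P : Type -> Prop) (K : Type) : Prop :=
  P K /\ forall L : Type, P L -> [set: K] #<= [set: L].

Lemma exists_least_set (T : Type) (F : set (set T)) (S0 : set T) :
  F S0 -> exists2 S, F S & forall S', F S' -> S #<= S'.
Proof.
move=> FS0.
pose P (A : set (set T -> T)) := forall S, F S ->
  (forall f, A f -> S (f S)) /\ (forall f g, A f -> A g -> f S = g S -> f = g).
have [A PA Amax] : exists2 A, P A & forall B, A `<` B -> ~ P B.
  have [C CP totC|A [PA Amax]] := @Zorn_bigcup _ P; last by exists A.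
  move=> S FS; split=> [f [B CB Bf]|f g [B CB Bf] [B' CB' B'g]].
    by have [+ _] := CP _ CB _ FS; apply.
  have [BB'|B'B] := totC _ _ CB CB'.
  - by have [_] := CP _ CB' _ FS; apply=> //; apply: BB'.
  - by have [_] := CP _ CB _ FS; apply=> //; apply: B'B.
suff [S FS imS] : exists2 S, F S & S `<=` [set f S | f in A].
  exists S => // S' FS'; apply: (@card_le_trans _ _ _ A).
    exact: card_le_trans (subset_card_le imS) (card_image_le _ _).
  have [Sf finj] := PA _ FS'.
  have finj' : {in A &, injective (fun f : set T -> T => f S')}.
    by move=> f g /set_mem Af /set_mem Ag; apply: finj.
  have := inj_card_eq finj'; rewrite card_eq_sym => /card_eqPle[+ _].
  move=> /card_le_trans; apply; apply: subset_card_le => _ [f Af <-].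
  exact: Sf.
apply: contrapT => noS.
have miss S : F S -> exists y, S y /\ ~ [set f S | f in A] y.
  move=> FS; apply: contrapT => nomiss; apply: noS; exists S => // y Sy.
  by apply: contrapT => nA; apply: nomiss; exists y.
have [y0 _] := miss _ FS0.
have /choice[g gP] : forall S, exists y, F S -> S y /\ ~ [set f S | f in A] y.
  move=> S; have [/miss[y]|nFS] := pselect (F S); first by exists y.
  by exists y0.
have nAg : ~ A g by move=> Ag; have [_] := gP _ FS0; apply; exists g.
apply: (Amax (A `|` [set g])).
  split; first by move=> f Af; left.
  by move=> /(_ g (or_intror erefl)).
move=> S FS; have [Sf finj] := PA _ FS; have [Sg gA] := gP _ FS; split.
  by move=> f [/Sf//|->].
move=> f h [Af|->] [Ah|->] // fh; first exact: finj.
- by exfalso; apply: gA; exists f.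
- by exfalso; apply: gA; exists h.
Qed.

Lemma card_eq_setT_range (T U : Type) (f : T -> U) :
  injective f -> range f #= [set: T].
Proof. by move=> finj; apply: inj_card_eq => x y _ _; apply: finj. Qed.

Lemma card_le_setT_total (K L : Type) :
  [set: K] #<= [set: L] \/ [set: L] #<= [set: K].
Proof.
have rl : range (@inl K L) #= [set: K] by apply: card_eq_setT_range => x y [].
have rr : range (@inr K L) #= [set: L] by apply: card_eq_setT_range => x y [].
have [_ [->|->] H] := @exists_least_set (K + L)%type
  [set range inl; range inr] _ (or_introl erefl).
- by left; rewrite -(card_le_eql rl) -(card_le_eqr rr); apply: H; right.
- by right; rewrite -(card_le_eqr rl) -(card_le_eql rr); apply: H; left.
Qed.

Lemma exists_least_cardinal (P : Type -> Prop) :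
  (exists K, P K) -> exists K, is_least_cardinal P K.
Proof.
move=> [K0 PK0].
have [S0 [K PK SK] Kmin] := @exists_least_set K0
  [set S | exists2 K, P K & S #= [set: K]] setT
  (ex_intro2 _ _ K0 PK0 (card_eqxx _)).
exists K; split=> // L PL; rewrite -(card_le_eql SK).
have [K0L|] := card_le_setT_total K0 L.
  apply: card_le_trans K0L; exact: card_leT.
move=> /card_subP[S SL _]; rewrite -(card_le_eqr SL); apply: Kmin.
by exists L.
Qed.

Definition least_cardinal (P : Type -> Prop) : Type :=
  match pselect (exists K, is_least_cardinal P K) with
  | left e => sval (cid e)
  | right _ => unit
  end.

Lemma least_cardinalP (P : Type -> Prop) :
  (exists K, P K) -> is_least_cardinal P (least_cardinal P).
Proof.
move=> /exists_least_cardinal exP; rewrite /least_cardinal.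
by case: pselect => // e; case: (cid e).
Qed.

Section cardinal_invariants.
Variable X : topologicalType.
Implicit Types (x : X) (B F : set (set X)).

Definition local_base x B : Prop :=
  B `<=` open_nbhs x /\ forall U, open_nbhs x U -> exists2 V, B V & V `<=` U.

(* Members of a local pi-base at [x] need not contain [x]. *)
Definition local_pi_base x B : Prop :=
  (forall V, B V -> open V /\ V !=set0) /\
  forall U, open_nbhs x U -> exists2 V, B V & V `<=` U.

Definition cellular F : Prop :=
  (forall U, F U -> open U /\ U !=set0) /\ trivIset F id.

Definition local_character x : Type :=
  least_cardinal (fun K => exists2 B, local_base x B & [set: K] #= B).

Definition local_pi_character x : Type :=
  least_cardinal (fun K => exists2 B, local_pi_base x B & [set: K] #= B).

(* The next three are suprema multiplied by omega, i.e. least infinite upper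
   bounds. *)
Definition character : Type :=
  least_cardinal (fun K => [set: nat] #<= [set: K] /\
    forall x, [set: local_character x] #<= [set: K]).

Definition pi_character : Type :=
  least_cardinal (fun K => [set: nat] #<= [set: K] /\
    forall x, [set: local_pi_character x] #<= [set: K]).

Definition cellularity : Type :=
  least_cardinal (fun K => [set: nat] #<= [set: K] /\
    forall F, cellular F -> F #<= [set: K]).

Definition urysohn_number : Type :=
  least_cardinal (fun K => forall A : set X, [set: K] #<= A ->
    exists U : X -> set X, (forall a, A a -> open_nbhs a (U a)) /\
      \bigcap_(a in A) closure (U a) = set0).

Definition n_urysohn (n : nat) : Prop := [set: urysohn_number] #<= `I_n.

(* The defining conditions above are all satisfiable, so that the invariants
   are genuine least cardinals. *)

Lemma card_eq_setT_sub T (A : set T) : [set: {a | A a}] #= A.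
Proof.
have valI : injective (@sval T A).
  by move=> [a Aa] [b Ab] /= ab; apply: eq_exist.
have rA : range (@sval T A) = A.
  by apply/seteqP; split=> [_ [[a Aa] _ <-]//|a Aa]; exists (exist _ a Aa).
by have := card_eq_setT_range valI; rewrite rA card_eq_sym.
Qed.

Lemma local_characterP x : is_least_cardinal
  (fun K => exists2 B, local_base x B & [set: K] #= B) (local_character x).
Proof.
apply: least_cardinalP; exists {V | open_nbhs x V}; exists (open_nbhs x).
  by split=> // U xU; exists U.
exact: card_eq_setT_sub.
Qed.

Lemma local_pi_characterP x : is_least_cardinal
  (fun K => exists2 B, local_pi_base x B & [set: K] #= B)
  (local_pi_character x).
Proof.
pose B := [set V : set X | open V /\ V !=set0].
apply: least_cardinalP; exists {V | B V}; exists B; last first.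
  exact: card_eq_setT_sub.
by split=> // U [oU xU]; exists U => //; split=> //; exists x.
Qed.

Let bound : Type := (nat + set X)%type.

Let nat_le_bound : [set: nat] #<= [set: bound].
Proof.
have : range (@inl nat (set X)) #= [set: nat].
  by apply: card_eq_setT_range => m n [].
by move=> /card_le_eql <-; exact: card_leT.
Qed.

Let family_le_bound B : B #<= [set: bound].
Proof.
apply: card_le_trans (card_leT B) _.
have : range (@inr nat (set X)) #= [set: set X].
  by apply: card_eq_setT_range => U V [].
by move=> /card_le_eql <-; exact: card_leT.
Qed.

Lemma characterP : is_least_cardinal (fun K => [set: nat] #<= [set: K] /\
  forall x, [set: local_character x] #<= [set: K]) character.
Proof.
apply: least_cardinalP; exists bound; split=> // x.
by have [[B _ /card_le_eql->] _] := local_characterP x.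
Qed.

Lemma pi_characterP : is_least_cardinal (fun K => [set: nat] #<= [set: K] /\
  forall x, [set: local_pi_character x] #<= [set: K]) pi_character.
Proof.
apply: least_cardinalP; exists bound; split=> // x.
by have [[B _ /card_le_eql->] _] := local_pi_characterP x.
Qed.

Lemma cellularityP : is_least_cardinal (fun K => [set: nat] #<= [set: K] /\
  forall F, cellular F -> F #<= [set: K]) cellularity.
Proof. by apply: least_cardinalP; exists bound; split. Qed.

Lemma card_lt_powerset T (A : set T) : ~ ([set: set T] #<= A).
Proof.
move=> /card_le_trans /(_ (card_leT A)); elim/Ppointed: T => T in A *.
  move=> /card_leP[f].
  by have [] := no (val (f (to_setT set0))).
move=> /pcard_leTP[f].
pose D := [set y | exists2 U : set T, f U = y & ~ U y].
have [DfD|nDfD] := pselect (D (f D)); last by apply: (nDfD); exists D.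
have [U fUD nU] := DfD.
have UD : U = D by apply: 'inj_f fUD; rewrite inE.
by apply: nU; rewrite UD.
Qed.

Lemma urysohn_numberP : is_least_cardinal
  (fun K => forall A : set X, [set: K] #<= A ->
    exists U : X -> set X, (forall a, A a -> open_nbhs a (U a)) /\
      \bigcap_(a in A) closure (U a) = set0) urysohn_number.
Proof.
apply: least_cardinalP; exists (set X) => A.
by move=> /card_lt_powerset.
Qed.

End cardinal_invariants.

(* Main.v *)
Require Import Defs.
From mathcomp Require Import all_boot.
From mathcomp Require Import boolp.
From mathcomp Require Import classical_sets functions cardinality topology.

Local Open Scope classical_set_scope.
Local Open Scope card_scope.

(** Let [K] be the product of the cellularity and the character of [X], an
    infinite cardinal, and let [P] be its pi-character. The idea is to exhibit a
    subset [A] of [X] with at most [P ^ K] points which has to be all of [X].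

    Fix at each point a local base indexed by [K]. The set [A] is closed under
    two operations. The first sends a net in [A], indexed by the finite lists of
    elements of [K], to its limits in the sense of closed neighbourhoods. Since
    [X] is [n]-Urysohn, a net has only finitely many such limits
    ([finite_theta_limits]): [n] of them would have neighbourhoods whose
    closures have no common point, while the net reaches all these closures at a
    common index. The second sends a family of [K]-many basic neighbourhoods of
    points of [A] to a point outside the closure of its union, if there is one.

    Such a set is everything ([closed_set_full]). If [q] is not in [A], then [q]
    is not a limit of a net in [A], so some open neighbourhood [V] of [q] has a
    closure disjoint from [A]. Each point of [A] then has a basic neighbourhood
    missing [V]. By the bound on the cellularity, [K]-many of these
    neighbourhoods have a union whose closure contains [A]
    ([cellularity_dense_subfamily]). As [A] is closed under the second
    operation, that closure is [X], which is absurd since the union misses [V].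

    The size of [A] is controlled without transfinite recursion
    ([closed_under_operations]). The operations have at most [K] arguments and
    are labelled by at most [P ^ K] parameters, and the points of [A] are the
    values of well-founded terms built from them. A term is determined by its
    labels along finite paths, so there are at most [P ^ K] terms. This uses
    that an infinite cardinal equals its square ([embeds_square]), which is
    obtained by applying Zorn's lemma to the pairing functions on subsets of
    [K]. *)

(** * Cardinal arithmetic *)

(** [T] has at most the cardinality of [U]. *)
Definition embeds (T U : Type) : Prop := exists f : T -> U, injective f.

Lemma embeds_card_le (T U : Type) : embeds T U <-> [set: T] #<= [set: U].
Proof.
split=> [[f finj]|].
  by rewrite -(card_le_eql (card_eq_setT_range finj)); exact: card_leT.
move=> /card_leP[f]; exists (fun x => val (f (to_setT x))) => x y /val_inj fxy.
have := @inj _ _ _ f (to_setT x) (to_setT y).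
rewrite !inE => /(_ Logic.I Logic.I fxy) /(congr1 val) //.
Qed.

Lemma embeds_trans {T U V : Type} : embeds T U -> embeds U V -> embeds T V.
Proof. by move=> [f fi] [g gi]; exists (g \o f); apply: inj_comp. Qed.

Lemma embeds_surj {T U : Type} (f : T -> U) :
  (forall y, exists x, f x = y) -> embeds U T.
Proof.
move=> /choice[g gK]; exists g => x y gxy.
by rewrite -(gK x) -(gK y) gxy.
Qed.

Lemma embeds_prod {T T' U U' : Type} :
  embeds T U -> embeds T' U' -> embeds (T * T') (U * U').
Proof.
move=> [f fi] [g gi]; exists (fun p => (f p.1, g p.2)).
by move=> [x y] [x' y'] /= [/fi-> /gi->].
Qed.

(** The graph [G] of an injection [S * S -> S], where [S] is the set of the
    elements on which the diagonal of [G] is defined. *)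
Definition pairing_graph {K : Type} (G : set (K * K * K)) : Prop :=
  let S x := exists z, G (x, x, z) in
  [/\ forall x y z z', G (x, y, z) -> G (x, y, z') -> z = z',
      forall x y x' y' z, G (x, y, z) -> G (x', y', z) -> x = x' /\ y = y',
      forall x y z, G (x, y, z) -> [/\ S x, S y & S z] &
      forall x y, S x -> S y -> exists z, G (x, y, z)].

Lemma pairing_graph_maximal {K : Type} (G0 : set (K * K * K)) :
  pairing_graph G0 ->
  exists G, [/\ G0 `<=` G, pairing_graph G &
    forall H, pairing_graph H -> G `<=` H -> H `<=` G].
Proof.
(* The set [G0] is added to the members of a chain so that the property also
   holds for the empty chain. *)
move=> PG0; pose P G := pairing_graph (G0 `|` G).
have [F FP totF|A [PA Amax]] := @Zorn_bigcup _ P; last first.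
  exists (G0 `|` A); split=> //.
  move=> H PH AH p Hp; apply: contrapT => nAp; apply: (Amax H).
    split; first by move=> x Ax; apply: AH; right.
    by move=> HA; apply: nAp; right; apply: HA.
  rewrite /P (_ : G0 `|` H = H) //; apply/seteqP; split=> x; last by right.
  by case=> // G0x; apply: AH; left.
have base p : (G0 `|` \bigcup_(X in F) X) p -> exists G, [/\ pairing_graph G,
    G p, G `<=` G0 `|` \bigcup_(X in F) X &
    G = G0 \/ exists2 X, F X & G = G0 `|` X].
  case=> [G0p|[X FX Xp]]; first by exists G0; split=> //; left.
  exists (G0 `|` X); split; [exact: FP|by right| |by right; exists X].
  by move=> x [?|?]; [left|right; exists X].
(* Two elements of the union of the chain belong to a common pairing graph
   contained in it, from which the four properties are inherited. *)
have common p q : (G0 `|` \bigcup_(X in F) X) p ->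
    (G0 `|` \bigcup_(X in F) X) q ->
    exists G, [/\ pairing_graph G, G p, G q & G `<=` G0 `|` \bigcup_(X in F) X].
  move=> /base[G [PG Gp GU HG]] /base[H [PH Hq HU HH]].
  case: HG => [|[X FX]] eG.
    exists H; split=> //; move: Gp; rewrite eG => G0p.
    by case: HH => [->//|[Y _ ->]]; left.
  case: HH => [|[Y FY]] eH.
    by exists G; split=> //; move: Hq; rewrite eH eG => ?; left.
  have [XY|YX] := totF _ _ FX FY.
    exists H; split=> //; move: Gp; rewrite eG eH.
    by case; [left|move=> /XY; right].
  exists G; split=> //; move: Hq; rewrite eG eH.
  by case; [left|move=> /YX; right].
split.
- move=> x y z z' /common + h => /(_ _ h)[G [[G1 _ _ _] Gp Gq _]].
  by apply: G1 Gp Gq.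
- move=> x y x' y' z /common + h => /(_ _ h)[G [[_ G2 _ _] Gp Gq _]].
  by apply: G2 Gp Gq.
- move=> x y z h; have [G [[_ _ G3 _] Gp _ GU]] := common _ _ h h.
  have [[a Ga] [b Gb] [c Gc]] := G3 _ _ _ Gp.
  by split; [exists a|exists b|exists c]; apply: GU.
- move=> x y [a xa] [b yb]; have [G [[_ _ _ G4] Gp Gq GU]] := common _ _ xa yb.
  have [|//|z Gz] := G4 x y; [by exists a|by exists b|].
  by exists z; apply: GU.
Qed.

Lemma pairing_graph_nat {K : Type} (i : nat -> K) : injective i ->
  exists2 G0 : set (K * K * K), pairing_graph G0 &
    forall n, exists z, G0 (i n, i n, z).
Proof.
move=> ii; pose c (m n : nat) := choice.pickle (m, n).
have ci m n m' n' : c m n = c m' n' -> m = m' /\ n = n'.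
  by move=> /(pcan_inj choice.pickleK) [-> ->].
exists [set p | exists m n, p = (i m, i n, i (c m n))]; last first.
  by move=> n; exists (i (c n n)), n, n.
split.
- by move=> x y z z' [m [n [-> -> ->]]] [m' [n' [/ii-> /ii-> ->]]].
- move=> x y x' y' z [m [n [-> -> ->]]] [m' [n' [-> -> /ii]]].
  by move=> /ci[-> ->].
- move=> x y z [m [n [-> -> ->]]]; split.
  + by exists (i (c m m)), m, m.
  + by exists (i (c n n)), n, n.
  + by exists (i (c (c m n) (c m n))), (c m n), (c m n).
- move=> x y [_ [m [_ [-> _ _]]]] [_ [n [_ [-> _ _]]]].
  by exists (i (c m n)), m, n.
Qed.

(** Hessenberg's theorem: an infinite cardinal is equal to its square. *)
Lemma embeds_square {K : Type} : embeds nat K -> embeds (K * K) K.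
Proof.
move=> [i ii]; have [G0 PG0 iG0] := pairing_graph_nat i ii.
have [G [G0G PG Gmax]] := pairing_graph_maximal G0 PG0.
pose S := [set x | exists z, G (x, x, z)].
have iS n : S (i n) by have [z /G0G] := iG0 n; exists z.
have [G1 G2 G3 G4] := PG.
(* [f] is the pairing function on [S] with graph [G]. *)
have /choice[f' f'P] : forall p : K * K, exists z, S p.1 -> S p.2 -> G (p, z).
  move=> [x y] /=; have [Sx|nS] := pselect (S x); last by exists x.
  have [Sy|nS] := pselect (S y); last by exists x.
  by have [z ?] := G4 _ _ Sx Sy; exists z.
pose f x y := f' (x, y).
have fG x y : S x -> S y -> G (x, y, f x y) by exact: (f'P (x, y)).
have fS x y : S x -> S y -> S (f x y).
  by move=> Sx Sy; have [] := G3 _ _ _ (fG x y Sx Sy).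
have fi x y x' y' : S x -> S y -> S x' -> S y' ->
    f x y = f x' y' -> x = x' /\ y = y'.
  move=> Sx Sy Sx' Sy' e; have := fG x' y' Sx' Sy'; rewrite -e.
  exact: G2 (fG x y Sx Sy).
pose T := {x | S x}.
have fT : embeds (T * T) T.
  exists (fun p => exist _ (f (sval p.1) (sval p.2))
    (fS _ _ (svalP p.1) (svalP p.2))).
  move=> [[x Sx] [y Sy]] [[x' Sx'] [y' Sy']] /= [] /fi.
  by move=> /(_ Sx Sy Sx' Sy') [ex ey]; congr (_, _); apply: eq_exist.
pose C := {x | ~ S x}.
have [TC|CT] := card_le_setT_total T C; last first.
  (* The complement of [S] is no larger than [S], so [K] embeds into [S]. *)
  have KT : embeds K T.
    move/embeds_card_le: CT => [h hi].
    have bT : embeds bool T.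
      exists (fun b : bool => exist _ (i b) (iS b)).
      by move=> [] [] // [] /ii.
    have bTT := embeds_trans (embeds_prod bT (ex_intro _ _ (@inj_id T))) fT.
    apply: embeds_trans bTT.
    exists (fun x => match pselect (S x) with
      | left Sx => (true, exist _ x Sx)
      | right nSx => (false, h (exist _ x nSx)) end).
    move=> x y; case: (pselect (S x)) => Sx; case: (pselect (S y)) => Sy //.
      by move=> [].
    by move=> [/hi[]].
  apply: embeds_trans (embeds_prod KT KT) (embeds_trans fT _).
  by exists sval => -[x Sx] [y Sy] /= exy; apply: eq_exist.
(* Otherwise [S] has a disjoint copy outside [S], over which the graph
   extends, against its maximality. *)
exfalso; move/embeds_card_le: TC => [h hi].
pose g x := match pselect (S x) with
  | left Sx => sval (h (exist _ x Sx))
  | right _ => x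
  end.
have gS x : S x -> ~ S (g x).
  by rewrite /g; case: pselect => // Sx _; case: (h _).
have gi x y : S x -> S y -> g x = g y -> x = y.
  rewrite /g; case: pselect => // Sx _; case: pselect => // Sy _ e.
  have /hi[]// : h (exist _ x Sx) = h (exist _ y Sy).
  by case: (h _) (h _) e => [a na] [b nb] /= e; apply: eq_exist.
(* Each element of the union of [S] and its copy is [tg b x] for a unique tag
   [b] and a unique [x] in [S]. A new pair is sent to the copy of a code of its
   two tags and two elements; [i] encodes the pair of tags. *)
pose tg (b : bool) x := if b then g x else x.
have tgi b b' x x' : S x -> S x' -> tg b x = tg b' x' -> b = b' /\ x = x'.
  move=> Sx Sx'; case: b b' => -[] //=.
  - by move=> /gi ->.
  - by move=> e; have := gS _ Sx; rewrite e.
  - by move=> e; have := gS _ Sx'; rewrite -e.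
pose cd (b b' : bool) x y := f (f x y) (i (b.*2 + b')).
have cdS b b' x y : S x -> S y -> S (cd b b' x y).
  by move=> Sx Sy; exact: (fS _ _ (fS _ _ Sx Sy) (iS _)).
have cdi b b' x y c c' x' y' : S x -> S y -> S x' -> S y' ->
    cd b b' x y = cd c c' x' y' -> [/\ b = c, b' = c', x = x' & y = y'].
  move=> Sx Sy Sx' Sy' /fi[]; [exact: fS|exact: iS|exact: fS|exact: iS|].
  move=> /fi[]// -> -> /ii e; split=> //; by case: b c b' c' e => -[] [] [].
pose H : set (K * K * K) := G `|` [set p | exists b b' x y,
  [/\ S x, S y, b || b' & p = (tg b x, tg b' y, g (cd b b' x y))]].
have HS x : (exists z, H (x, x, z)) <-> exists b s, S s /\ x = tg b s.
  split=> [[z [Gx|[b [b' [s [s' [Ss _ _ [-> _ _]]]]]]]]|[b [s [Ss ->]]]].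
  - by exists false, x; split=> //; exists z.
  - by exists b, s.
  - case: b => /=; last by have [z Gz] := Ss; exists z; left.
    by exists (g (cd true true s s)); right; exists true, true, s, s.
have HGS x y z : G (x, y, z) -> [/\ S x, S y & S z] by apply: G3.
suff PH : pairing_graph H.
  have : S (g (i 0)).
    exists (g (cd true true (i 0) (i 0))).
    apply: (Gmax H PH); first by move=> ?; left.
    by right; exists true, true, (i 0), (i 0).
  by apply: gS.
have new_out b b' x y : b || b' -> S x -> S y -> S (tg b x) -> ~ S (tg b' y).
  case: b b' => -[] //= _ Sx Sy.
  - by move=> /(gS _ Sx).
  - by move=> /(gS _ Sx).
  - by move=> _; apply: gS.
split.
- move=> x y z z' [Gz|[b [b' [s [s' [Ss Ss' bb [-> -> ->]]]]]]].
    case=> [|[b [b' [s [s' [Ss Ss' bb [ex ey _]]]]]]]; first exact: G1 Gz.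
    have [Sx Sy _] := HGS _ _ _ Gz.
    rewrite ex in Sx; rewrite ey in Sy.
    by case: (new_out _ _ _ _ bb Ss Ss' Sx Sy).
  case=> [Gz|[c [c' [t [t' [St St' cc [e e' ->]]]]]]].
    have [Sx Sy _] := HGS _ _ _ Gz.
    by case: (new_out _ _ _ _ bb Ss Ss' Sx Sy).
  have [-> ->] := tgi _ _ _ _ Ss St e.
  by have [-> ->] := tgi _ _ _ _ Ss' St' e'.
- move=> x y x' y' z [Gz|[b [b' [s [s' [Ss Ss' bb [-> -> ->]]]]]]].
    case=> [|[b [b' [s [s' [Ss Ss' bb [_ _ ez]]]]]]]; first exact: G2 Gz.
    have [_ _ Sz] := HGS _ _ _ Gz.
    by rewrite ez in Sz; case: (gS _ (cdS b b' _ _ Ss Ss')).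
  case=> [Gz|[c [c' [t [t' [St St' cc [-> -> e]]]]]]].
    have [_ _ Sz] := HGS _ _ _ Gz.
    by case: (gS _ (cdS b b' _ _ Ss Ss')).
  have {}e := gi _ _ (cdS _ _ _ _ Ss Ss') (cdS _ _ _ _ St St') e.
  by have [-> -> -> ->] := cdi _ _ _ _ _ _ _ _ Ss Ss' St St' e.
- move=> x y z [Gz|[b [b' [s [s' [Ss Ss' bb [-> -> ->]]]]]]].
    have [Sx Sy Sz] := HGS _ _ _ Gz.
    by split; apply/HS; exists false; [exists x|exists y|exists z].
  split; apply/HS; [by exists b, s|by exists b', s'|].
  by exists true, (cd b b' s s'); split; first exact: cdS.
- move=> x y /HS[b [s [Ss ->]]] /HS[b' [s' [Ss' ->]]].
  have [bb|] := boolP (b || b').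
    by exists (g (cd b b' s s')); right; exists b, b', s, s'.
  by case: b b' => -[] //= _; have [z Gz] := G4 _ _ Ss Ss'; exists z; left.
Qed.

Lemma embeds_list {K : Type} : embeds nat K -> embeds (list K) K.
Proof.
move=> natK; have KK := embeds_square natK; have [p pi] := KK.
have [i _] := natK.
have idK : embeds K K by exists id.
apply: embeds_trans (embeds_trans (embeds_prod natK idK) KK).
exists (fun s : list K => (size s, foldr (fun x y => p (x, y)) (i 0) s)).
elim=> [|x s IH] [|y t] //= [st] /pi[-> e]; congr (_ :: _).
by apply: IH; rewrite st e.
Qed.

(** * Sets closed under operations with many arguments *)

Lemma embeds_fun_dom {T U V : Type} (v0 : V) :
  embeds T U -> embeds (T -> V) (U -> V).
Proof.
move=> [f fi].
have /choice[r rf] : forall u, exists ot : option T,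
    forall t, f t = u -> ot = Some t.
  move=> u; have [[t <-]|nu] := pselect (exists t, f t = u).
    by exists (Some t) => t' /fi ->.
  by exists None => t ft; case: nu; exists t.
exists (fun (h : T -> V) u => if r u is Some t then h t else v0) => h h' e.
by apply/funext => t; have := congr1 (@^~ (f t)) e; rewrite /= (rf _ t).
Qed.

Lemma embeds_fun_codom {T U V : Type} : embeds U V -> embeds (T -> U) (T -> V).
Proof.
move=> [f fi]; exists (fun h t => f (h t)) => h h' e.
by apply/funext => t; apply: fi; exact: (congr1 (@^~ t) e).
Qed.

(** Over an infinite [K], the power [P ^ K] is stable under powers with
    exponent at most [K]. *)
Lemma embeds_fun_power {K P T U : Type} (p0 : P) : embeds nat K ->
  embeds T K -> embeds U (K -> P) -> embeds (T -> U) (K -> P).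
Proof.
move=> natK TK UP; apply: embeds_trans (embeds_fun_codom UP) _.
have TKK : embeds (T * K) K.
  have idK : embeds K K by exists id.
  exact: embeds_trans (embeds_prod TK idK) (embeds_square natK).
apply: embeds_trans (embeds_fun_dom p0 TKK).
exists (fun h p => h p.1 p.2) => h h' e.
by apply/funext => t; apply/funext => k; exact: (congr1 (@^~ (t, k)) e).
Qed.

Lemma embeds_prod_power {K P T U : Type} (p0 : P) : embeds nat K ->
  embeds T (K -> P) -> embeds U (K -> P) -> embeds (T * U) (K -> P).
Proof.
move=> natK [f fi] [g gi].
have bK : embeds bool K.
  by apply: embeds_trans natK; exists nat_of_bool => -[] [].
apply: embeds_trans (embeds_fun_power p0 natK bK (ex_intro _ _ (@inj_id _))).
exists (fun p (b : bool) => if b then f p.1 else g p.2) => -[x y] [x' y'] e.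
have /= /fi -> := congr1 (@^~ true) e.
by have /= /gi -> := congr1 (@^~ false) e.
Qed.

Lemma embeds_power {K P : Type} : embeds bool P -> embeds K (K -> P).
Proof.
move=> [p pi]; exists (fun k k' => p `[< k' = k >]) => k k' e.
have /pi := congr1 (@^~ k) e.
by rewrite /= asboolT // => /esym/asboolP.
Qed.

(** Formal expressions over operations labelled by [I], each with one argument
    for each element of [J]. *)
Inductive term (I J : Type) : Type :=
  | Base : term I J
  | Apply : I -> (J -> term I J) -> term I J.
Arguments Base {I J}.
Arguments Apply {I J} _ _.

(** The label at the end of the path [s] from the root of [t]. The boolean tells
    whether it is the label of an operation; at [Base], and beyond it, the
    label is the default [i0]. *)
Fixpoint term_label {I J : Type} (i0 : I) (t : term I J) (s : list J) :
    bool * I :=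
  match t, s with
  | Base, _ => (false, i0)
  | Apply i f, nil => (true, i)
  | Apply i f, cons j s' => term_label i0 (f j) s'
  end.

(** A term is determined by its labels along all finite paths. *)
Lemma term_label_inj {I J : Type} (i0 : I) : injective (@term_label I J i0).
Proof.
elim=> [|i f IH] [|i' f'] // e; try by have := congr1 (@^~ [::]) e.
have [->] := congr1 (@^~ [::]) e; congr (Apply _ _).
apply/funext => j; apply: IH; apply/funext => s.
exact: (congr1 (@^~ (j :: s)) e).
Qed.

(** The value of a term for the operations [op], with [Base] sent to [x0]. *)
Fixpoint term_eval {X I J : Type} (op : I -> (J -> X) -> X) (x0 : X)
    (t : term I J) : X :=
  match t with
  | Base => x0
  | Apply i f => op i (fun j => term_eval op x0 (f j))
  end.

(** Operations with at most [K] arguments and at most [P ^ K] labels admit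
    a nonempty closed set of at most [P ^ K] points: the values of terms. *)
Lemma closed_under_operations {X I J K P : Type} (op : I -> (J -> X) -> X)
    (i0 : I) (x0 : X) :
  embeds nat K -> embeds bool P -> embeds J K -> embeds I (K -> P) ->
  exists A : set X, [/\ A x0,
    forall i d, (forall j, A (d j)) -> A (op i d) & embeds {x | A x} (K -> P)].
Proof.
move=> natK bP JK IP; have [p _] := bP; have p0 := p true.
pose A x := exists t, term_eval op x0 t = x.
exists A; split.
- by exists Base.
- move=> i d /choice[f fd]; exists (Apply i f) => /=.
  by congr op; apply/funext.
- have AT : embeds {x | A x} (term I J).
    apply: (embeds_surj (fun t => exist A _ (ex_intro _ t erefl))).
    by move=> [x [t tx]]; exists t; apply: eq_exist.
  apply: embeds_trans AT _.
  apply: embeds_trans (ex_intro _ _ (term_label_inj i0)) _.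
  apply: embeds_fun_power => //.
    have [f fi] := JK; apply: embeds_trans (embeds_list natK).
    by exists (map f); exact: inj_map.
  apply: embeds_prod_power => //.
  have bK : embeds bool K.
    by apply: embeds_trans natK; exists nat_of_bool => -[] [].
  exact: embeds_trans bK (embeds_power bP).
Qed.

(** * Topology *)

(** [u x] enumerates, with repetitions, a local base at each point [x]. *)
Definition local_base_family {X : topologicalType} {K : Type}
    (u : X -> K -> set X) : Prop :=
  forall x, (forall k, open_nbhs x (u x k)) /\
    (forall U, open_nbhs x U -> exists k, u x k `<=` U).

Lemma exists_local_base_family (X : topologicalType) (K : Type) :
  embeds (character X) K ->
  exists u : X -> K -> set X, local_base_family u.
Proof.
move=> chiK.
suff xv : forall x : X, exists v : K -> set X,
    (forall k, open_nbhs x (v k)) /\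
    (forall U, open_nbhs x U -> exists k, v k `<=` U).
  by have [u uP] := choice xv; exists u.
move=> x; have [[B [Bx Bfine] eB] _] := local_characterP x.
have [[_ chi_ge] _] := characterP X.
have [f fi] : embeds {V | B V} K.
  apply: embeds_trans chiK.
  apply: embeds_trans _ ((embeds_card_le _ _).2 (chi_ge x)).
  apply/embeds_card_le; rewrite (card_le_eqr eB).
  by have /card_eqPle[] := card_eq_setT_sub B.
have /choice[v vP] : forall k, exists V, B V /\ forall b, f b = k -> V = sval b.
  move=> k; have [[b <-]|nk] := pselect (exists b, f b = k).
    by exists (sval b); split; [exact: svalP|move=> b' /fi ->].
  have [V BV _] := Bfine setT (open_nbhsT x).
  by exists V; split=> // b fb; case: nk; exists b.
exists v; split=> [k|U /Bfine[V BV VU]]; first by have [/Bx] := vP k.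
exists (f (exist _ V BV)).
by have [_ /(_ _ erefl) ->] := vP (f (exist _ V BV)).
Qed.

Lemma notin_closure {X : topologicalType} (B : set X) x :
  ~ closure B x -> exists2 W, open_nbhs x W & W `&` B = set0.
Proof.
move=> nx; apply: contrapT => nW; apply: nx => V; rewrite nbhsE => -[W xW WV].
apply: contrapT => nV; apply: nW; exists W => //.
apply/eqP/negPn/negP => /set0P[y [Wy By]]; apply: nV; exists y; split=> //.
exact: WV.
Qed.

Lemma open_nbhs_notin_closure {X : topologicalType} (B W : set X) x :
  open_nbhs x W -> W `&` B = set0 -> ~ closure B x.
Proof.
move=> xW WB /(_ W (open_nbhs_nbhs xW))[y [By Wy]].
by have : (W `&` B) y by []; rewrite WB.
Qed.

(** A family of open sets has a subfamily of size at most the cellularity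
    whose union is dense in the union of the family. *)
Lemma cellularity_dense_subfamily {X : topologicalType} {I K : Type}
    (D : set I) (g : I -> set X) :
  embeds (cellularity X) K -> D !=set0 -> (forall i, D i -> open (g i)) ->
  exists h : K -> I, (forall k, D (h k)) /\
    \bigcup_(i in D) g i `<=` closure (\bigcup_k g (h k)).
Proof.
move=> cK [i0 Di0] gO.
(* A maximal cellular family [F] refining the family [g] yields the subfamily:
   choose for each member of [F] a member of [g] that contains it. *)
pose P (F : set (set X)) :=
  cellular F /\ forall U, F U -> exists2 i, D i & U `<=` g i.
have [F FP totF|F [[Fcell Fg] Fmax]] := @Zorn_bigcup _ P.
  split; last by move=> U [E FE EU]; have [_] := FP _ FE; apply.
  split; first by move=> U [E FE EU]; have [[+ _] _] := FP _ FE; apply.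
  move=> U V [E FE EU] [E' FE' E'V].
  have [EE'|E'E] := totF _ _ FE FE'.
    by have [[_ +] _] := FP _ FE'; apply=> //; exact: EE'.
  by have [[_ +] _] := FP _ FE; apply=> //; exact: E'E.
have [j ji] : embeds {U | F U} K.
  apply: embeds_trans cK; apply/embeds_card_le.
  have [[_ /(_ F Fcell) Fc] _] := cellularityP X.
  by apply: card_le_trans Fc; have /card_eqPle[] := card_eq_setT_sub F.
have /choice[h hP] : forall k, exists i, D i /\
    forall c, j c = k -> sval c `<=` g i.
  move=> k; have [[c <-]|nk] := pselect (exists c, j c = k).
    have [i Di ci] := Fg _ (svalP c).
    by exists i; split=> // c' /ji ->.
  by exists i0; split=> // c jc; case: nk; exists c.
exists h; split=> [k|x [i Di gix]]; first by have [] := hP k.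
(* A neighbourhood [W] of [x] missing the subfamily would allow [F] to be
   enlarged by the trace of [W] on [g i]. *)
apply: contrapT => nx.
have [W xW WH] := notin_closure _ _ nx.
have [oW Wx] := xW.
pose N := W `&` g i.
have Nx : N x by [].
have NF c : F c -> c `&` N = set0.
  move=> Fc; have [_ /(_ (exist _ c Fc) erefl) /= cg] := hP (j (exist _ c Fc)).
  apply/eqP/negPn/negP => /set0P[y [cy [Wy _]]].
  suff : (W `&` \bigcup_k g (h k)) y by rewrite WH.
  by split=> //; exists (j (exist _ c Fc)) => //; exact: cg.
have nFN : ~ F N by move=> /NF; rewrite setIid => N0; rewrite N0 in Nx.
apply: (Fmax (F `|` [set N])).
  by split=> [c Fc|/(_ N) FN]; [left|apply: nFN; apply: FN; right].
have [Fo Ft] := Fcell.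
split; last by move=> U [/Fg//|->]; exists i => // y [].
split.
  move=> U [/Fo//|->]; split; last by exists x.
  by apply: openI oW _; exact: gO.
move=> U V [FU|->] [FV|->] //; first exact: Ft.
  by rewrite NF // => -[].
by rewrite setIC NF // => -[].
Qed.

(** The intersection of the members of the family [u x] with indices in [l]. *)
Fixpoint base_cap {X K : Type} (u : X -> K -> set X) (x : X) (l : list K) :
    set X :=
  if l is k :: l' then u x k `&` base_cap u x l' else setT.

Lemma open_nbhs_base_cap {X : topologicalType} {K : Type}
    (u : X -> K -> set X) x l :
  local_base_family u -> open_nbhs x (base_cap u x l).
Proof.
move=> uP; elim: l => [|k l IH] /=; first exact: open_nbhsT.
by apply: open_nbhsI IH; have [] := uP x.
Qed.

(** The limits of the net [d], indexed by the finite lists of indices, in the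
    sense that the members of the net need only belong to the closures of the
    neighbourhoods of the limit. The same list is used at all points, which is
    why the net is not indexed by the neighbourhoods of one point. *)
Definition theta_limits {X : topologicalType} {K : Type} (u : X -> K -> set X)
    (d : list K -> X) : set X :=
  [set x | forall l, closure (base_cap u x l) (d l)].

(** Were there infinitely many limits, separate [n] of them by neighbourhoods
    whose closures have no common point: a basic neighbourhood inside each of
    these gives a list at which the net belongs to all the closures. *)
Lemma finite_theta_limits {X : topologicalType} {K : Type}
    (u : X -> K -> set X) (n : nat) (d : list K -> X) :
  local_base_family u -> n_urysohn X n -> finite_set (theta_limits u d).
Proof.
move=> uP Xn; apply: contrapT => infL.
have [A AL An] : exists2 A, A `<=` theta_limits u d & A #= `I_n.
  have : `I_n #<= theta_limits u d.
    move/infiniteP : infL; apply: card_le_trans; exact: card_leT.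
  by move=> /card_subP[A An AL]; exists A.
have [+ _] := urysohn_numberP X => /(_ A).
have -> : [set: urysohn_number X] #<= A by rewrite (card_le_eqr An).
move=> /(_ isT)[U [AU U0]].
have /choice[k kP] : forall x, exists k, A x -> u x k `<=` U x.
  move=> x; have [/AU Ux|nAx] := pselect (A x).
    by have [_ /(_ _ Ux)[k]] := uP x; exists k.
  by have [_ /(_ _ (open_nbhsT x))[k]] := uP x; exists k.
have /finite_seqP[s As] : finite_set A by exists n.
have cap_le x : x \in s -> base_cap u x (map k s) `<=` u x (k x).
  elim: s {As} => // y s IH; rewrite inE => /predU1P[->|/IH xs] z /= [] //.
  by move=> _ /xs.
have : (\bigcap_(a in A) closure (U a)) (d (map k s)).
  move=> x Ax; apply: (closureS _ (AL _ Ax (map k s))).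
  apply: subset_trans (kP _ Ax); apply: cap_le; by move: Ax; rewrite As.
by rewrite U0.
Qed.

(** If [q] were outside [A], then [A] would miss the closure of a basic
    neighbourhood [V] of [q], for otherwise [q] would be a limit of a net in
    [A]. Basic neighbourhoods of points of [A] that miss [V] thus cover [A], and
    [K]-many of them have a union dense in [A], hence in [X], although this
    union misses [V]. *)
Lemma closed_set_full {X : topologicalType} {K : Type}
    (u : X -> K -> set X) (A : set X) :
  local_base_family u -> embeds (cellularity X) K -> A !=set0 ->
  (forall d, (forall l, A (d l)) -> theta_limits u d `<=` A) ->
  (forall (s : K -> X) (t : K -> K), (forall k, A (s k)) ->
    A `<=` closure (\bigcup_k u (s k) (t k)) ->
    closure (\bigcup_k u (s k) (t k)) = setT) ->
  A = setT.
Proof.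
move=> uP cK [a0 Aa0] Alim Adense; apply/seteqP; split=> // q _.
apply: contrapT => nAq.
have [l lA] : exists l, forall a, A a -> ~ closure (base_cap u q l) a.
  apply: contrapT => nl; apply: nAq.
  have /choice[d dP] : forall l, exists a, A a /\ closure (base_cap u q l) a.
    move=> l; apply: contrapT => na; apply: nl; exists l => a Aa qa.
    by apply: na; exists a.
  by apply: (Alim d) => l; have [] := dP l.
set V := base_cap u q l in lA.
have qV : open_nbhs q V := open_nbhs_base_cap u q l uP.
pose D : set (X * K) := [set p | A p.1 /\ u p.1 p.2 `&` V = set0].
have AD a : A a -> exists k, D (a, k).
  move=> Aa; have [W aW WV] := notin_closure _ _ (lA _ Aa).
  have [_ /(_ _ aW)[k kW]] := uP a; exists k; split=> //.
  by apply/seteqP; split=> // y [/kW Wy Vy]; rewrite -WV.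
have [k0 Dk0] := AD _ Aa0.
have [] := cellularity_dense_subfamily D (fun p => u p.1 p.2) cK.
- by exists (a0, k0).
- by move=> [a k] _; have [/(_ k)[]] := uP a.
move=> h [hD Dh].
have := Adense (fun k => (h k).1) (fun k => (h k).2) (fun k => (hD k).1).
have Acl : A `<=` closure (\bigcup_k u (h k).1 (h k).2).
  move=> a Aa; have [k Dak] := AD _ Aa; apply: Dh; exists (a, k) => //.
  by have [/(_ k)[]] := uP a.
move=> /(_ Acl) => clT.
apply: (open_nbhs_notin_closure (\bigcup_k u (h k).1 (h k).2) V q) => //.
  rewrite setIC; apply/seteqP; split=> // y [[k _ uy] Vy].
  by have [_ <-] := hD k.
by rewrite clT.
Qed.

Lemma power_bound_of_n_urysohn {X : topologicalType} {K P : Type} (n : nat) :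
  n_urysohn X n -> embeds nat K -> embeds bool P ->
  embeds (cellularity X) K -> embeds (character X) K ->
  embeds X (K -> P).
Proof.
move=> Xn natK bP cK chiK.
have [x0|X0] := pselect (exists x : X, True); last first.
  by exists (fun x => False_rect _ (X0 (ex_intro _ x Logic.I))) => x;
    case: X0; exists x.
case: x0 => x0 _.
have [u uP] := exists_local_base_family X K chiK.
have /choice[lim limP] : forall d, exists e : nat -> X,
    theta_limits u d `<=` range e.
  move=> d; have /finite_seqP[s ds] := finite_theta_limits u n d uP Xn.
  exists (nth x0 s) => x; rewrite ds => /= xs.
  by exists (index x s) => //; rewrite nth_index.
have /choice[out outP] : forall B : set X, exists x,
    closure B = setT \/ ~ closure B x.
  move=> B; have [BT|] := pselect (closure B = setT); first by exists x0; left.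
  by move=> /eqP/setTPn[x Bx]; exists x; right.
(* The label [(t, 0)] picks a point outside the closure of the union of the
   basic neighbourhoods selected by [t] at the values of [d] on one-element
   lists; the label [(t, m.+1)] picks the limit of [d] numbered [m]. *)
pose op (i : (K -> K) * nat) (d : list K -> X) :=
  if i.2 is m.+1 then lim d m
  else out (\bigcup_k u (d [:: k]) (i.1 k)).
have [p _] := bP; have p0 := p true.
have [A [Ax0 Aop AP]] : exists A : set X, [/\ A x0,
    forall i d, (forall l, A (d l)) -> A (op i d) & embeds {x | A x} (K -> P)].
  apply: (closed_under_operations op (id, 0) x0 natK bP (embeds_list natK)).
  have KP := @embeds_power K P bP.
  apply: embeds_prod_power => //; last exact: embeds_trans natK KP.
  by apply: embeds_fun_power => //; exists id.
suff AT : A = setT.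
  apply: embeds_trans AP; rewrite AT.
  by exists (fun x => exist _ x Logic.I) => x y [].
apply: (closed_set_full u) => //; first by exists x0.
  move=> d Ad x /limP[m _ <-]; exact: (Aop (id, m.+1)).
move=> s t As Acl; set B := \bigcup_k _.
have AB : A (out B).
  by apply: (Aop (t, 0) (fun l => if l is k :: _ then s k else x0)) => -[].
by have [//|nB] := outP B; case: nB; exact: Acl.
Qed.

Theorem theorem3p19 (n : nat) (X : topologicalType) :
  (2 <= n)%N -> n_urysohn X n ->
  [set: X] #<= [set: (cellularity X * character X)%type -> pi_character X].
Proof.
move=> _ Xn; apply/embeds_card_le.
have [[/embeds_card_le[i ii] _] _] := cellularityP X.
have [[/embeds_card_le[j ji] _] _] := characterP X.
have [[/embeds_card_le[p pi] _] _] := pi_characterP X.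
apply: (power_bound_of_n_urysohn n Xn).
- by exists (fun m => (i m, j 0)) => m m' [/ii].
- by exists (fun b : bool => p b) => -[] [] // /pi.
- by exists (fun c => (c, j 0)) => c c' [].
- by exists (fun c => (i 0, c)) => c c' [].
Qed.
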